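(* Let $n\in\mathbb{N}$, $\mathbf{y}=(y_1,y_2,\dots,y_n)\in\mathbb{N}^n$, and $\mathbf{y}^+=(y_1,\dots,y_n,y_{n+1})\in\mathbb{N}^{n+1}$. (a) If $(1^{n-d},\mathbf{w})\in\mathsf{PA}^{\mathrm{inv}}_n(\mathbf{y})$, where $\mathbf{w}\in\mathbb{N}_{>1}^d$, then $(1^{n-d+1},\mathbf{w}_{\widehat{i}})\in\mathsf{PA}^{\mathrm{inv}}_n(\mathbf{y})$ for all $i\in[d]$. (b) The image of $\deg:\mathsf{PA}^{\mathrm{inv}}_n(\mathbf{y})\to\{0,1,\dots,n-1\}$ is $\{0,1,\dots,\chi(\mathbf{y})\}$. In other words, for each $d\in\{0,1,\dots,\chi(\mathbf{y})\}$ there exists $\mathbf{x}\in\mathsf{PA}^{\mathrm{inv}}_n(\mathbf{y})$ with $\deg\mathbf{x}=d$. (c) If $\mathbf{x}\in\mathsf{PA}^{\mathrm{inv}}_n(\mathbf{y})$, then $(1,\mathbf{x})\in\mathsf{PA}^{\mathrm{inv}}_{n+1}(\mathbf{y}^+)$. In particular, $\mathbf{x}\mapsto(1,\mathbf{x})$ defines an injective map $\eta:\mathsf{PA}^{\mathrm{inv},\uparrow}_n(\mathbf{y})\hookrightarrow\mathsf{PA}^{\mathrm{inv},\uparrow}_{n+1}(\mathbf{y}^+)$. (d) If $\chi(\mathbf{y})=\alpha$, then $\chi(\mathbf{y}^+)\in\{\alpha,\alpha+1\}$.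
   Context: $\mathbb{N}=\{1,2,3,\dots\}$, $\mathbb{N}_{>1}=\{2,3,\dots\}$, and $[n]=\{1,\dots,n\}$. Let $\mathbf{y}=(y_1,\dots,y_n)\in\mathbb{N}^n$ and $m=\sum_{i=1}^n y_i$. Consider a one-way street with $m$ parking spots numbered $1,\dots,m$ and $n$ cars entering in order $1,2,\dots,n$, where car $i$ has length $y_i$ and prefers spot $x_i\in[m]$. Car $i$ drives to spot $x_i$ and parks in $x_i,x_i+1,\dots,x_i+y_i-1$ if these spots exist and are all unoccupied; otherwise it parks in the next $y_i$ contiguous available spots, i.e. it occupies $s,s+1,\dots,s+y_i-1$ for the smallest $s\ge x_i$ such that $s+y_i-1\le m$ and all these spots are unoccupied; if no such $s$ exists, parking fails. The vector $\mathbf{x}=(x_1,\dots,x_n)\in[m]^n$ is a parking assortment for $\mathbf{y}$ if all cars can park; the set of these is $\mathsf{PA}_n(\mathbf{y})$. A parking assortment $\mathbf{x}$ is (permutation) invariant if every permutation of its entries is also in $\mathsf{PA}_n(\mathbf{y})$; $\mathsf{PA}^{\mathrm{inv}}_n(\mathbf{y})$ is the set of invariant parking assortments for $\mathbf{y}$, and $\mathsf{PA}^{\mathrm{inv},\uparrow}_n(\mathbf{y})\subseteq\mathsf{PA}^{\mathrm{inv}}_n(\mathbf{y})$ is its subset of nondecreasing elements. For $\mathbf{x}\in\mathsf{PA}^{\mathrm{inv}}_n(\mathbf{y})$ the degree is $\deg\mathbf{x}=|\{i\in[n]:x_i\ne 1\}|$, and the characteristic of $\mathbf{y}$ is $\chi(\mathbf{y})=\max_{\mathbf{z}\in\mathsf{PA}^{\mathrm{inv}}_n(\mathbf{y})}\deg\mathbf{z}$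 (all of this applies to $\mathbf{y}^+$ with $n+1$ in place of $n$). List notation: for $\mathbf{v}=(v_1,\dots,v_d)$, $\mathbf{v}_{\widehat{i}}=(v_1,\dots,v_{i-1},v_{i+1},\dots,v_d)$ is $\mathbf{v}$ with the $i$th entry deleted; $(1^k,\mathbf{v})=(1,\dots,1,v_1,\dots,v_d)$ with $k$ leading ones; $(1,\mathbf{v})=(1^1,\mathbf{v})$. *)

(* Defs.v *)
From mathcomp Require Import all_boot.

Set Implicit Arguments.
Unset Strict Implicit.
Unset Printing Implicit Defensive.

(* Lists of cars' lengths and preferences are [seq nat]; the parking spots are *)
(* numbered from 1 to m, where m is the sum of the lengths.                    *)

Definition fits (m : nat) (occ : seq nat) (s l : nat) : bool :=
  (s + l <= m.+1) && all (fun k => k \notin occ) (iota s l).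

(* The candidates [iota x (m.+1 - x)] are x, ..., m in increasing order, so    *)
(* the head of the filtered list is the smallest admissible s >= x.            *)
Definition park_spot (m : nat) (occ : seq nat) (x l : nat) : option nat :=
  ohead [seq s <- iota x (m.+1 - x) | fits m occ s l].

Fixpoint all_park (m : nat) (occ xs ls : seq nat) : bool :=
  match xs, ls with
  | [::], [::] => true
  | x :: xs', l :: ls' =>
      if park_spot m occ x l is Some s
      then all_park m (iota s l ++ occ) xs' ls' else false
  | _, _ => false
  end.

Definition PA (y : seq nat) : pred (seq nat) :=
  [pred x | [&& size x == size y, all (fun a => 1 <= a <= sumn y) x
              & all_park (sumn y) [::] x y]].

Definition PAinv (y : seq nat) : pred (seq nat) :=
  [pred x | (x \in PA y) && all (fun x' => x' \in PA y) (permutations x)].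

Definition PAinv_up (y : seq nat) : pred (seq nat) :=
  [pred x | (x \in PAinv y) && sorted leq x].

Definition deg (x : seq nat) : nat := count (fun a => a != 1) x.

(* Entries of members of [PA y] are at most [sumn y], so every member is of    *)
(* the form [map val z] below; the value 0 of the ordinals is ruled out by     *)
(* [PA].                                                                       *)
Definition chi (y : seq nat) : nat :=
  \max_(z : (size y).-tuple 'I_(sumn y).+1 | map val z \in PAinv y)
    deg (map val z).

(* 0-based: [del_nth i v] deletes the (i+1)-st entry of v.                     *)
Definition del_nth (i : nat) (v : seq nat) : seq nat :=
  take i v ++ drop i.+1 v.

(* Main.v *)
(* Replacing an entry by 1: write a rearrangement of the modified vector as
   A ++ 1 :: B and compare it with A ++ r :: B, all of whose rearrangements park.
   When the car preferring 1 arrives, the least preference u among r :: B is at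
   most the leftmost hole, as that hole still has to be filled; so the car parks
   exactly as one preferring u would.  If u = r this is a known run; otherwise u
   occurs in B, and at that occurrence u again acts as 1 while r is still unused,
   so one recurses.  Prepending a 1 follows, since the first n cars then carry an
   invariant vector with at most one entry replaced by 1.  Conversely, deleting a
   largest entry from an invariant vector for y+ gives one for y, because a car
   with the largest preference arriving last can only park at the very end. *)
Require Import Defs.
From mathcomp Require Import all_boot.
From mathcomp Require Import zify.

Set Implicit Arguments.
Unset Strict Implicit.
Unset Printing Implicit Defensive.

(** * Single parking steps and occupied spots *)

(** Since [0 < l], a start that fits is at most [m], so ending the candidates at [m] loses none. *)
Lemma park_spotP m occ x l s : 0 < l ->
  reflect [/\ x <= s, fits m occ s l & forall t, x <= t < s -> ~~ fits m occ t l]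
          (park_spot m occ x l == Some s).
Proof.
move=> l_gt0; rewrite /park_spot.
have fits_le t : fits m occ t l -> t < m.+1 by move=> /andP[]; lia.
move En: (m.+1 - x) => n.
elim: n x En => [|n IHn] x En /=.
  apply: (iffP idP) => // -[xs /fits_le]; lia.
case: ifPn => /= fx.
  apply: (iffP eqP) => [[<-]|[xs _ min]].
    by split=> // t; lia.
  congr Some; apply/eqP; rewrite eqn_leq xs leqNgt; apply/negP=> lt_xs.
  by move: (min x); rewrite leqnn lt_xs fx => /(_ isT).
have /IHn IH : m.+1 - x.+1 = n by lia.
apply: (iffP IH) => -[xs fs min]; split=> //.
- exact: ltnW.
- by move=> t /andP[]; rewrite leq_eqVlt => /predU1P[<- //|xt ts]; apply: min; rewrite xt.
- by rewrite ltn_neqAle xs andbT; apply: contraNneq fx => ->.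
- by move=> t /andP[xt ts]; apply: min; rewrite ltnW.
Qed.

Lemma all_park_consP m occ x xs l ls : 0 < l ->
  reflect (exists s, [/\ x <= s, fits m occ s l,
      forall t, x <= t < s -> ~~ fits m occ t l
      & all_park m (iota s l ++ occ) xs ls])
    (all_park m occ (x :: xs) (l :: ls)).
Proof.
move=> l_gt0 /=; case E: (park_spot m occ x l) => [s|]; last first.
  apply: (iffP idP) => // -[s [xs0 fs min _]].
  by move: E; have /eqP -> : park_spot m occ x l == Some s by apply/park_spotP.
apply: (iffP idP) => [ap|[t [xt ft min]]].
  by move/eqP: E => /(park_spotP _ _ _ _ l_gt0)[xs0 fs min]; exists s.
suff /eqP : park_spot m occ x l == Some t by rewrite E => -[->].
exact/park_spotP.
Qed.

(** Without repetitions [size occ] counts the occupied spots, so the recurring hypothesis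
    [size occ + sumn ls = m] says that the remaining cars exactly fill the street. *)
Definition spots m (occ : seq nat) := uniq occ && all (fun k => 0 < k <= m) occ.

Lemma spotsS m occ s l : spots m occ -> 0 < s -> fits m occ s l ->
  spots m (iota s l ++ occ).
Proof.
move=> /andP[Uo Bo] s_gt0 /andP[le_sl /allP free].
rewrite /spots cat_uniq iota_uniq Uo all_cat Bo !andbT.
apply/andP; split.
  by apply/hasPn=> k ko; apply/negP=> /free; rewrite ko.
by apply/allP=> k; rewrite mem_iota; lia.
Qed.

Lemma spots_full m occ : spots m occ -> size occ = m ->
  forall k, (k \in occ) = (0 < k <= m).
Proof.
move=> /andP[Uo /allP Bo] so k.
have sub : {subset occ <= iota 1 m} by move=> j /Bo; rewrite mem_iota; lia.
have [|_ ->] := uniq_min_size Uo sub; first by rewrite size_iota so.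
by rewrite mem_iota; lia.
Qed.

Lemma all_park_le m occ xs ls : all_park m occ xs ls -> all (fun x => x <= m) xs.
Proof.
elim: xs ls occ => [|x xs IH] [|l ls] occ //=.
case E: park_spot => [s|//] /IH ->; rewrite andbT leqNgt.
by apply: contra_eqN E => lt_mx; rewrite /park_spot (eqP (_ : m.+1 - x == 0)) // subn_eq0.
Qed.

(** A car preferring a spot beyond [h] leaves [h] empty, while the street is full once all cars have
    parked. *)
Lemma hole_pref m occ xs ls h : spots m occ -> size occ + sumn ls = m ->
  all (leq 1) ls -> all (leq 1) xs -> all_park m occ xs ls ->
  0 < h <= m -> h \notin occ -> has (fun u => u <= h) xs.
Proof.
elim: xs ls occ => [|x xs IH] [|l ls] occ //= So sz.
  by move=> _ _ _ hm; rewrite (spots_full So) ?hm //; lia.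
move=> /andP[l0 ls0] /andP[x0 xs0] /(all_park_consP _ _ _ _ _ l0)[s [le_xs fs _ ap]] hm ho.
case: leqP => //= lt_hx; apply: IH ap hm _ => //.
- by apply: spotsS => //; lia.
- by rewrite size_cat size_iota; lia.
- by rewrite mem_cat mem_iota (negPf ho) orbF; lia.
Qed.

(** * Replacing a preference by one with no hole below it *)

Lemma fits_free m occ s l k : fits m occ s l -> s <= k < s + l -> k \notin occ.
Proof. by move=> /andP[_ /allP free] sk; apply: free; rewrite mem_iota. Qed.

(** No positive start below [u] or below [v] fits, so both preferences lead to the leftmost start
    that fits. *)
Lemma all_park_low_pref m occ u v xs ls : all (leq 1) ls -> 0 < u -> 0 < v ->
  (forall k, 0 < k < u -> k \in occ) -> (forall k, 0 < k < v -> k \in occ) ->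
  all_park m occ (u :: xs) ls -> all_park m occ (v :: xs) ls.
Proof.
case: ls => [|l ls] //= /andP[l0 _] u0 v0 lowu lowv.
move=> /(all_park_consP _ _ _ _ _ l0)[s [us fs min ap]].
have nofit t w : (forall k, 0 < k < w -> k \in occ) -> 0 < t < w -> ~~ fits m occ t l.
  by move=> low tw; apply/negP=> /(@fits_free _ _ _ _ t); rewrite low //; lia.
apply/(all_park_consP _ _ _ _ _ l0); exists s; split=> //.
  by case: leqP => // sv; move: (nofit s v lowv); rewrite fs; lia.
move=> t /andP[vt ts]; case: (leqP u t) => ut; first by apply: min; rewrite ut.
by apply: nofit lowu _; lia.
Qed.

(** The order is a parameter because both a least entry ([leq]) and a largest one ([geq]) are
    wanted. *)
Lemma ex_first (T : eqType) (le : rel T) r R : total le -> transitive le ->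
  exists2 u, u \in r :: R & {in r :: R, forall v, le u v}.
Proof.
move=> le_total le_trans; have := sort_sorted le_total (r :: R).
have memE := mem_sort le (r :: R).
case: sort memE => [|u s] memE; first by have := memE r; rewrite mem_head.
rewrite /= path_sortedE // => /andP[/allP min_u _].
exists u; first by rewrite -memE mem_head.
move=> v; rewrite -memE inE => /predU1P[->|/min_u //].
by have := le_total u u; rewrite orbb.
Qed.

(* [v] generalizes the entry 1 so that the recursive call can take [v := u]. *)
Lemma all_park_replace m occ A r R v ls : spots m occ -> size occ + sumn ls = m ->
  all (leq 1) ls -> all (leq 1) (A ++ r :: R) -> 0 < v ->
  (forall k, 0 < k < v -> k \in occ) ->
  (forall zs, perm_eq zs (A ++ r :: R) -> all_park m occ zs ls) ->
  all_park m occ (A ++ v :: R) ls.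
Proof.
elim: ls occ A r R v => [|l ls IH] occ A r R v So sz ls0 xs0 v0 low good.
  by move: (good _ (perm_refl _)); case: A {xs0 good}.
have l0 : 0 < l by case/andP: ls0.
have ls0' : all (leq 1) ls by case/andP: ls0.
(* The spot taken by the first car does not depend on later preferences, so one [occ'] serves every
   continuation [zs]. *)
have park x xs : 0 < x -> all_park m occ (x :: xs) (l :: ls) ->
    exists occ', [/\ spots m occ', size occ' + sumn ls = m, {subset occ <= occ'}
      & forall zs, all_park m occ (x :: zs) (l :: ls) = all_park m occ' zs ls].
  move=> x0 /=; case E: park_spot => [s|//] _; exists (iota s l ++ occ).
  have /(park_spotP _ _ _ _ l0)[xs' fs _] := introT eqP E.
  split=> //; first by apply: spotsS => //; lia.
    by rewrite size_cat size_iota; move: sz => /=; lia.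
  by move=> k ko; rewrite mem_cat ko orbT.
case: A xs0 good => [|a A] xs0 good.
  have [u uR minu] := ex_first r R leq_total leq_trans.
  have u0 : 0 < u by move/allP: xs0; apply.
  have lowu k : 0 < k < u -> k \in occ.
    move=> ku; apply: contraT => ko.
    have um : u <= m by move/allP: (all_park_le (good _ (perm_refl _))); apply.
    have km : 0 < k <= m by lia.
    have /hasP[w /minu] := hole_pref So sz ls0 xs0 (good _ (perm_refl _)) km ko.
    lia.
  apply: (all_park_low_pref ls0 u0 v0 lowu low).
  move: uR; rewrite inE => /predU1P[->|uR]; first exact: good (perm_refl _).
  case/splitPr: uR xs0 good {minu} => R1 R2 xs0 good.
  (* After a car preferring [u], every rearrangement of [R1 ++ r :: R2] parks. What remains to be
     run is [R1 ++ u :: R2], so the induction applies with [u] for [v]. *)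
  have good' zs : perm_eq zs (R1 ++ r :: R2) -> all_park m occ (u :: zs) (l :: ls).
    move=> pz; apply: good.
    rewrite -cat_cons perm_sym (perm_catCA (r :: R1) [:: u] R2) /=.
    by rewrite perm_cons perm_sym (permPl pz) (perm_catCA R1 [:: r] R2).
  have [occ' [So' sz' sub E]] := park _ _ u0 (good' _ (perm_refl _)).
  rewrite E; apply: (IH _ _ r) => //.
  - by move: xs0; rewrite /= !all_cat /= => /and4P[-> -> _ ->].
  - by move=> k /lowu /sub.
  - by move=> zs /good'; rewrite E.
have /andP[a0 xs0'] := xs0.
have [occ' [So' sz' sub E]] := park _ _ a0 (good _ (perm_refl _)).
rewrite cat_cons E; apply: (IH _ _ r) => //; first by move=> k /low /sub.
by move=> zs pz; rewrite -E; apply: good; rewrite /= perm_cons.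
Qed.

(** * Adding and removing a last car *)

(** Lengthening the street changes no earlier choice: a start before the chosen one ends before it,
    hence within the first [m] spots. These are full when the last car arrives, so it parks at
    [m.+1]. *)
Lemma all_park_rcons m l occ xs ls q : spots m occ -> size occ + sumn ls = m ->
  0 < l -> all (leq 1) ls -> all (leq 1) xs -> 0 < q <= m.+1 ->
  all_park m occ xs ls -> all_park (m + l) occ (rcons xs q) (rcons ls l).
Proof.
move=> So sz l0 + + qm.
elim: xs ls occ So sz => [|x xs IH] [|a ls] occ So sz.
- move=> _ _ _; rewrite addn0 in sz; have full := spots_full So sz.
  apply/(all_park_consP _ _ _ _ _ l0); exists m.+1; split=> //; first by case/andP: qm.
    apply/andP; split; first by rewrite addSn.
    by apply/allP=> k; rewrite mem_iota full; lia.
  move=> t tq; apply/negP=> /(@fits_free _ _ _ _ t); rewrite full; lia.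
- by [].
- by [].
move=> /andP[a0 ls0] /andP[x0 xs0] /(all_park_consP _ _ _ _ _ a0)[s [xs' fs min ap]].
have /andP[le_s free] := fs.
apply/(all_park_consP _ _ _ _ _ a0); exists s; split=> //.
- by rewrite /fits free andbT; lia.
- move=> t xt; move: (min t xt); apply: contra => /andP[_ free_t].
  by rewrite /fits free_t andbT; lia.
apply: IH ap => //; first by apply: spotsS => //; lia.
by rewrite size_cat size_iota; move: sz => /=; lia.
Qed.

(* No car prefers a spot beyond [p], so the occupied spots from [p] on form an
   interval starting at [p]; the last car then leaves no spot behind it. *)
Lemma all_park_belast m l occ xs ls p : spots (m + l) occ -> size occ + sumn ls = m ->
  0 < l -> all (leq 1) ls -> all (fun x => 0 < x <= p) xs -> 0 < p ->
  (forall j k, p <= j <= k -> k \in occ -> j \in occ) ->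
  all_park (m + l) occ (rcons xs p) (rcons ls l) ->
  spots m occ && all_park m occ xs ls.
Proof.
move=> So sz l0 + + p0.
elim: xs ls occ So sz => [|x xs IH] [|a ls] occ So sz.
- move=> _ _ itv /(all_park_consP _ _ _ _ _ l0)[g [pg fg _ _]]; rewrite addn0 in sz.
  case/andP: So => Uo /allP Bo; rewrite /spots Uo !andbT /=.
  (* By [itv], an occupied spot from [g] on would make [g] occupied. So the [m] occupied spots all
     lie below [g], and [g <= m.+1] because the last car fits; hence [g] is [m.+1]. *)
  have lt_g k : k \in occ -> 0 < k < g.
    move=> ko; have := Bo k ko; case: (ltnP k g) => gk; first by lia.
    have /negP[] : g \notin occ by apply: fits_free fg _; lia.
    by apply: itv ko; rewrite pg.
  have sub : {subset occ <= iota 1 g.-1} by move=> k /lt_g; rewrite mem_iota; lia.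
  have := uniq_leq_size Uo sub; rewrite size_iota sz => mg.
  by case/andP: fg => le_g _; apply/allP=> k /lt_g; lia.
- by move=> _ _ _ /=; case: park_spot => // s; case: (ls).
- by move=> _ _ _ /=; case: park_spot => // s; case: (xs).
move=> /andP[a0 ls0] /andP[x0 xs0] itv.
move=> /(all_park_consP _ _ _ _ _ a0)[s [xs' fs min ap]].
have /andP[le_s /allP free] := fs.
have So' : spots (m + l) (iota s a ++ occ) by apply: spotsS => //; lia.
have sz' : size (iota s a ++ occ) + sumn ls = m.
  by rewrite size_cat size_iota; move: sz => /=; lia.
(* If [j] with [p <= j < s] were free, so would be everything after it by [itv], and the current
   car, preferring at most [p], would have parked at [j] or earlier. *)
have itv' j k : p <= j <= k -> k \in iota s a ++ occ -> j \in iota s a ++ occ.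
  move=> pj; rewrite !mem_cat !mem_iota => /orP[sk|/itv->]; rewrite ?orbT //.
  case: (leqP s j) => sj; first by rewrite (_ : j < s + a) //; lia.
  rewrite /=; apply: contraT => jo.
  have /negP[] : ~~ fits (m + l) occ j a by apply: min; lia.
  apply/andP; split; first by lia.
  apply/allP=> i; rewrite mem_iota => ij; apply: contra jo; apply: itv; lia.
have /andP[/andP[_ /allP Bm] ap'] := IH _ _ So' sz' ls0 xs0 itv' ap.
(* The bound from the induction is read at the last spot of the current car. *)
have le_sm : s + a <= m.+1.
  by have := Bm (s + a).-1; rewrite mem_cat mem_iota; lia.
apply/andP; split.
  case/andP: So => Uo _; rewrite /spots Uo; apply/allP=> k ko.
  by apply: Bm; rewrite mem_cat ko orbT.
apply/(all_park_consP _ _ _ _ _ a0); exists s; split=> //.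
- by rewrite /fits le_sm; apply/allP.
- move=> t xt; move: (min t xt); apply: contra => /andP[le_t free_t].
  by rewrite /fits free_t andbT; lia.
Qed.

(** * Invariant parking assortments *)

Lemma PAP y x : reflect [/\ size x = size y, all (fun a => 0 < a <= sumn y) x
    & all_park (sumn y) [::] x y] (x \in PA y).
Proof. by apply: (iffP and3P) => -[/eqP]. Qed.

Lemma PAinvP y x : reflect (forall z, perm_eq z x -> z \in PA y) (x \in PAinv y).
Proof.
apply: (iffP andP) => [[_ /allP inv] z zx|inv].
  by apply: inv; rewrite mem_permutations.
split; first exact: inv.
by apply/allP=> z; rewrite mem_permutations; apply: inv.
Qed.

Lemma PAinv_perm y x z : perm_eq z x -> x \in PAinv y -> z \in PAinv y.
Proof.
by move=> zx /PAinvP inv; apply/PAinvP=> t tz; apply/inv/(perm_trans tz).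
Qed.

Lemma range_leq1 m x : all (fun a => 0 < a <= m) x -> all (leq 1) x.
Proof. by apply: sub_all => a /andP[]. Qed.

(** By invariance the replaced entry may be put at the head, so this covers every entry. The street
    starts empty, and no spot lies below 1. *)
Lemma PAinv_replace1 y r R : all (leq 1) y -> r :: R \in PAinv y -> 1 :: R \in PAinv y.
Proof.
move=> y0 /PAinvP inv; apply/PAinvP=> z pz.
have z1 : 1 \in z by rewrite (perm_mem pz) mem_head.
case/splitPr: z1 pz => A B pz.
have pR : perm_eq (A ++ r :: B) (r :: R).
  by move: pz; rewrite (perm_catCA A [:: r] B) (perm_catCA A [:: 1] B) !perm_cons.
have /PAP[szR boundR apR] := inv _ pR.
apply/PAP; split.
- by rewrite -szR !size_cat.
- move: boundR; rewrite !all_cat /= => /and3P[-> /andP[r0 rm] ->].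
  by rewrite (leq_trans r0 rm).
apply: (@all_park_replace _ _ _ r) => //.
- exact: range_leq1 boundR.
- by case.
by move=> t pt; have /PAP[] := inv t (perm_trans pt pR).
Qed.

(** Spot 1 is a hole at the start, and only a preference of at most 1 can fill it. *)
Lemma PAinv_mem1 y x : all (leq 1) y -> y != [::] -> x \in PAinv y -> 1 \in x.
Proof.
move=> y0 yN /PAinvP/(_ _ (perm_refl x))/PAP[sz bound ap].
have sy0 : 0 < sumn y by case: y yN y0 {sz bound ap} => //= a y _ /andP[]; lia.
have s0 : spots (sumn y) [::] by [].
have /hasP[] := hole_pref s0 (add0n _) y0 (range_leq1 bound) ap (sy0 : 0 < 1 <= _) isT.
move=> u ux u1; rewrite (_ : 1 = u) //.
by move/allP: (range_leq1 bound) => /(_ u ux); lia.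
Qed.

Lemma PAinv_cons1 y l x : all (leq 1) y -> 0 < l ->
  x \in PAinv y -> 1 :: x \in PAinv (rcons y l).
Proof.
move=> y0 l0 inv; apply/PAinvP=> z; case/lastP: z => [|z q].
  by move/perm_size.
rewrite perm_rcons => pz.
have /PAP[sz bound ap] : z \in PA y.
  have : q \in 1 :: x by rewrite -(perm_mem pz) mem_head.
  (* Before the last car, the preferences are a rearrangement of [x] if [q] is the added 1, and
     otherwise of [x] with one [q] replaced by 1. *)
  rewrite inE => /predU1P[q1|qx].
    by move: pz; rewrite q1 perm_cons; apply/PAinvP.
  have px := perm_to_rem qx.
  have : 1 :: rem q x \in PAinv y.
    by apply/(PAinv_replace1 (r := q) y0)/PAinv_perm/inv; rewrite perm_sym.
  move/PAinvP; apply; rewrite -(perm_cons q) (permPl pz).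
  by rewrite perm_sym (perm_catCA [:: q] [:: 1]) /= perm_cons perm_sym.
have bq : 0 < q <= (sumn y).+1.
  have : q \in 1 :: x by rewrite -(perm_mem pz) mem_head.
  have /PAP[_ /allP bx _] := (PAinvP _ _ inv) _ (perm_refl x).
  by rewrite inE => /predU1P[->//|/bx]; lia.
apply/PAP; rewrite sumn_rcons !size_rcons sz all_rcons; split=> //.
  apply/andP; split; first by lia.
  by apply: sub_all bound => a; lia.
by apply: all_park_rcons => //; apply: range_leq1 bound.
Qed.

Lemma PAinv_belast y l p R : all (leq 1) y -> 0 < l -> {in R, forall v, v <= p} ->
  p :: R \in PAinv (rcons y l) -> R \in PAinv y.
Proof.
move=> y0 l0 maxp /PAinvP inv; apply/PAinvP=> z zR.
have /PAP[sz bound ap] : rcons z p \in PA (rcons y l).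
  by apply: inv; rewrite perm_rcons perm_cons.
have [p0 z0] : 0 < p /\ all (leq 1) z.
  by move: (range_leq1 bound); rewrite all_rcons => /andP[].
rewrite sumn_rcons in ap.
have /andP[_ apz] : spots (sumn y) [::] && all_park (sumn y) [::] z y.
  apply: all_park_belast ap => //.
  by apply/allP=> v vz; rewrite (allP z0) // maxp // -(perm_mem zR).
apply/PAP; split=> //; first by move: sz; rewrite !size_rcons => -[].
by apply/allP=> v vz; rewrite (allP z0 v vz); apply: (allP (all_park_le apz)).
Qed.

(** * Degrees and the characteristic *)

Lemma PAinv_nseq1 y : all (leq 1) y -> nseq (size y) 1 \in PAinv y.
Proof.
elim/last_ind: y => [|y l IH]; first by [].
by rewrite all_rcons size_rcons => /andP[l0 y0]; apply: PAinv_cons1 => //; apply: IH.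
Qed.

Lemma perm_deg x z : perm_eq x z -> deg x = deg z.
Proof. by move/permP; apply. Qed.

(** Replacing an entry other than 1 by 1 lowers the degree by exactly one. *)
Lemma PAinv_deg_le y x d : all (leq 1) y -> x \in PAinv y -> d <= deg x ->
  exists2 z, z \in PAinv y & deg z = d.
Proof.
move=> y0; move dx: (deg x) => k; elim: k x dx => [|k IH] x dx inv.
  by rewrite leqn0 => /eqP->; exists x.
rewrite leq_eqVlt => /predU1P[->|]; last rewrite ltnS => dk; first by exists x.
have /hasP[r rx r1] : has (fun a => a != 1) x by rewrite has_count -/(deg x) dx.
have px := perm_to_rem rx.
apply: (IH (1 :: rem r x)) (dk).
  by move: dx; rewrite (perm_deg px) /deg /= r1 => -[].
by apply: (@PAinv_replace1 _ r) => //; apply: PAinv_perm inv; rewrite perm_sym.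
Qed.

Lemma leq_chi y x : x \in PAinv y -> deg x <= chi y.
Proof.
move=> inv; have /PAP[sz /allP bound _] := (PAinvP _ _ inv) _ (perm_refl x).
(* No entry falls back to the default of [inord], as all are at most [sumn y]. *)
pose z := map (fun a => inord a : 'I_(sumn y).+1) x.
have szz : size z == size y by rewrite size_map sz.
have zx : map val (Tuple szz) = x.
  rewrite /= -map_comp -[RHS]map_id; apply/eq_in_map => a /bound am /=.
  by rewrite inordK // ltnS; case/andP: am.
by rewrite -[x in deg x]zx; apply: leq_bigmax_cond; rewrite zx.
Qed.

Lemma chi_attained y : all (leq 1) y -> exists2 x, x \in PAinv y & deg x = chi y.
Proof.
(* An empty maximum is 0, so a positive [chi y] comes from a nonempty family; the value 0 is
   attained by the all-ones vector. *)
move=> y0; have [c0|] := posnP (chi y).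
  by exists (nseq (size y) 1); [apply: PAinv_nseq1 | rewrite c0 /deg count_nseq].
rewrite /chi => c0.
pose P := [pred z : (size y).-tuple 'I_(sumn y).+1 | map val z \in PAinv y].
have : 0 < #|P|.
  by rewrite lt0n; apply: contraTneq c0 => /card0_eq P0; rewrite big_pred0.
case/(eq_bigmax_cond (fun z : _.-tuple _ => deg (map val z))) => z Pz ->.
by exists (map val z).
Qed.

Lemma perm_del_nth d (w : d.-tuple nat) (i : 'I_d) s :
  perm_eq (s ++ w) (tnth w i :: s ++ del_nth i w).
Proof.
have iw : i < size w by rewrite size_tuple.
rewrite -{1}(cat_take_drop i w) (drop_nth 0 iw) -tnth_nth.
by rewrite /del_nth !catA (perm_catCA (s ++ take i w) [:: _] (drop i.+1 w)).
Qed.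

Theorem theorem4 (n : nat) (hn : 0 < n) (y : n.-tuple nat)
    (hy : forall i : 'I_n, 0 < tnth y i) (yn1 : nat) (hyn1 : 0 < yn1) :
  [/\ (* (a) *)
      forall (d : nat) (w : d.-tuple nat), d <= n ->
        (forall j : 'I_d, 1 < tnth w j) ->
        nseq (n - d) 1 ++ w \in PAinv y ->
        forall i : 'I_d, nseq (n - d + 1) 1 ++ del_nth i w \in PAinv y,
      (* (b) *)
      (forall x : seq nat, x \in PAinv y -> deg x <= n - 1) /\
      (forall d : nat,
         (exists2 x : seq nat, x \in PAinv y & deg x = d) <-> d <= chi y),
      (* (c) *)
      (forall x : seq nat, x \in PAinv y -> 1 :: x \in PAinv (rcons y yn1)) /\
      (forall x : seq nat,
         x \in PAinv_up y -> 1 :: x \in PAinv_up (rcons y yn1)) /\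
      {in PAinv_up y &, injective (cons 1)}
    & (* (d) *)
      forall alpha : nat, chi y = alpha ->
        chi (rcons y yn1) = alpha \/ chi (rcons y yn1) = alpha.+1].
Proof.
have y0 : all (leq 1) y by apply/all_tnthP.
have yN : y != [::] :> seq nat by rewrite -size_eq0 size_tuple -lt0n.
have y0' : all (leq 1) (rcons y yn1) by rewrite all_rcons hyn1.
split.
- move=> d w _ _ inv i; rewrite addn1 /=.
  apply: (@PAinv_replace1 _ (tnth w i)) => //; apply: PAinv_perm inv.
  by rewrite perm_sym perm_del_nth.
- split=> [x inv|d].
    have := count_predC (pred1 1) x; rewrite -[count (predC _) _]/(deg x).
    have : 0 < count (pred1 1) x by rewrite -has_count has_pred1 (PAinv_mem1 y0 yN inv).
    have /PAP[-> _ _] := (PAinvP _ _ inv) _ (perm_refl x); rewrite size_tuple; lia.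
  split=> [[x inv <-]|d_le]; first exact: leq_chi.
  have [x inv dx] := chi_attained y0.
  by apply: PAinv_deg_le inv _; rewrite ?dx.
- split; first by move=> x; apply: PAinv_cons1.
  split; last by move=> x z _ _ [].
  move=> x /andP[inv sx]; apply/andP; split; first exact: PAinv_cons1.
  have /PAP[_ bound _] := (PAinvP _ _ inv) _ (perm_refl x).
  by rewrite /= path_min_sorted // (range_leq1 bound).
move=> alpha <-.
have lo : chi y <= chi (rcons y yn1).
  have [x inv <-] := chi_attained y0.
  by rewrite -[deg x]/(deg (1 :: x)); apply/leq_chi/PAinv_cons1.
(* Deleting a largest entry [p] from an assortment of maximal degree lowers the degree by [p != 1],
   which is at most 1. *)
suff hi : chi (rcons y yn1) <= (chi y).+1 by lia.
have [x inv <-] := chi_attained y0'.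
have [p px maxp] : exists2 p, p \in x & {in x, forall v, v <= p}.
  have := PAinv_mem1 y0' _ inv; rewrite -size_eq0 size_rcons => /(_ isT).
  case: (x) => [//|r R] _; apply: (ex_first (le := geq)) => [a b|b a c ab bc].
    exact: leq_total.
  exact: leq_trans bc ab.
have pxr := perm_to_rem px.
rewrite (perm_deg pxr) /deg /= -[leqRHS]add1n.
apply: leq_add; first exact: leq_b1.
apply/leq_chi/(@PAinv_belast _ yn1 p) => //.
  by move=> v /mem_rem/maxp.
by apply: PAinv_perm inv; rewrite perm_sym.
Qed.
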